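(* Let $n\ge 3$, let $K\subseteq\mathbb R^n$ be a proper cone, let $A\in\mathbb R^{n\times n}$ be a symmetric matrix, $b\in\mathbb R^n$, $c\in\mathbb R$, and let $f:\mathbb S^n\cap\operatorname{int}(K)\to\mathbb R$ be defined by $f(x)=\langle Ax,x\rangle+\langle b,x\rangle+c$. Then $f$ is spherically convex if and only if $$\frac12\langle b,x\rangle\le\liminf_{\substack{y\to x\\ \|y\|=1\\ y\in K}}\frac{\langle Ay-Ax,y-x\rangle}{\|y-x\|^2}-\langle Ax,x\rangle$$ for all $x\in\mathbb S^n\cap\operatorname{int}(K)$ (the lower limit being taken over $y\ne x$).
   Context: $\langle x,y\rangle=x^\top y$ is the canonical inner product on $\mathbb R^n$, $\|\cdot\|$ the Euclidean norm, and $\mathbb S^n=\{x\in\mathbb R^n:\|x\|=1\}$. A set $K\subseteq\mathbb R^n$ is a proper cone if $\lambda x\in K$ for all $x\in K,\lambda>0$; $x+y\in K$ for all $x,y\in K$; there is no $x\in K\setminus\{0\}$ with $-x\in K$; $K$ is closed; and $K$ has nonempty interior $\operatorname{int}(K)$. Geodesics of $\mathbb S^n$ are great circles (intersections of $\mathbb S^n$ with two-dimensional subspaces); a minimal geodesic segment is a shortest great-circle arc joining two points, parametrized proportionally to arc length. For a proper cone $K$, a function $f:\mathbb S^n\cap\operatorname{int}(K)\to\mathbb R$ is spherically convex if for every minimal geodesic segment $\gamma:J\to\mathbb S^n\cap\operatorname{int}(K)$ ($J$ an interval), the composition $f\circ\gamma$ is convex on $J$. *)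

(* Defs.v *)
From HB Require Import structures.
From mathcomp Require Import all_boot all_order all_algebra.
From mathcomp Require Import all_classical all_reals all_analysis.

Set Implicit Arguments.
Unset Strict Implicit.
Unset Printing Implicit Defensive.
Import Order.TTheory GRing.Theory Num.Theory.
Import numFieldNormedType.Exports.
Local Open Scope classical_set_scope.
Local Open Scope ring_scope.

Definition inner (R : realType) (n : nat) (x y : 'cV[R]_n) : R :=
  (x^T *m y) 0 0.

(* The norm `|x| of the library on matrices is the sup norm; it defines the
   same topology as [enorm], so closedness, interiors and limits below use the
   library topology on 'cV[R]_n. *)
Definition enorm (R : realType) (n : nat) (x : 'cV[R]_n) : R :=
  Num.sqrt (inner x x).

Definition sphere (R : realType) (n : nat) : set 'cV[R]_n :=
  [set x | enorm x = 1].
Arguments sphere : clear implicits.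

Record proper_cone (R : realType) (n : nat) (K : set 'cV[R]_n) : Prop :=
  ProperCone {
    proper_cone_scale : forall (x : 'cV[R]_n) (l : R),
      K x -> 0 < l -> K (l *: x);
    proper_cone_add : forall x y : 'cV[R]_n, K x -> K y -> K (x + y);
    proper_cone_pointed : ~ (exists x : 'cV[R]_n, [/\ K x, x <> 0 & K (- x)]);
    proper_cone_closed : closed K;
    proper_cone_solid : interior K !=set0
  }.

Definition great_circle (R : realType) (n : nat) (U : {vspace 'cV[R]_n}) :
    set 'cV[R]_n :=
  sphere R n `&` [set` U].

(* On J, g runs along a great circle with constant speed k: for orthogonal
   points p, v of the circle, t |-> cos t *: p + sin t *: v parametrizes it by
   arc length.  The arc of g over `[a, b] thus has length k * (b - a).  Constant
   curves (k = 0) are allowed. *)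
Definition great_circle_curve (R : realType) (n : nat) (J : set R)
    (g : R -> 'cV[R]_n) (k : R) : Prop :=
  0 <= k /\
  exists (U : {vspace 'cV[R]_n}) (p v : 'cV[R]_n),
    [/\ \dim U = 2%N, great_circle U p, great_circle U v, inner p v = 0 &
        forall t, J t -> g t = cos (k * t) *: p + sin (k * t) *: v].

(* J is an arbitrary interval, so minimality is required of the arcs of g over
   all compact subintervals of J; when J = `[a, b] this says that g itself is a
   shortest great-circle arc from g a to g b. *)
Definition minimal_geodesic (R : realType) (n : nat) (J : set R)
    (g : R -> 'cV[R]_n) : Prop :=
  is_interval J /\
  exists k : R,
    great_circle_curve J g k /\
    forall a b : R, J a -> J b -> a <= b ->
    forall (a' b' : R) (g' : R -> 'cV[R]_n) (k' : R),
      a' <= b' -> great_circle_curve `[a', b'] g' k' ->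
      g' a' = g a -> g' b' = g b ->
      k * (b - a) <= k' * (b' - a').

(* Only the values of f on the intersection of the sphere with the interior of
   K matter. *)
Definition spherically_convex (R : realType) (n : nat) (K : set 'cV[R]_n)
    (f : 'cV[R]_n -> R) : Prop :=
  forall (J : set R) (g : R -> 'cV[R]_n),
    minimal_geodesic J g ->
    (forall t, J t -> (sphere R n `&` interior K) (g t)) ->
    convex_function (J : set (convex_lmodType R^o)) (f \o g).

(* Main.v *)
Require Import Defs.
From HB Require Import structures.
From mathcomp Require Import all_boot all_order all_algebra.
From mathcomp Require Import all_classical all_reals all_analysis.
From mathcomp Require Import ring lra.

(** Both sides of the equivalence are restatements of one pointwise condition,
    [tangential_bound]: at every point x of the domain and for every unit vector
    v orthogonal to x,

      <A x, x> + (1/2) <b, x> <= <A v, v>.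

    It says that f has nonnegative second derivative along great circles.  If
    the unit speed great circle g passes through x with velocity v, then
    (f o g)'' = 2 <A v, v> - 2 <A x, x> - <b, x>, because g'' = - g.

    Spherical convexity.  Given the bound, (f o g)'' >= 0 on the parameter
    interval, and a function with nonnegative second derivative is convex
    ([tangential_bound_spherically_convex]).  Conversely
    ([spherically_convex_tangential_bound]), short arcs of great circles around x
    are minimal geodesics, since the distance on the circle is read off from the
    cosine, which is injective on [0, pi].  Midpoint convexity on the arc of
    parameters [-s, s] says
    2 f(x) <= f(g(s)) + f(g(-s)), and the part of f that is odd in s cancels:
    what is left is (1 - cos s) <b, x> <= sin^2 s (<A v, v> - <A x, x>).
    Division by 1 - cos s and s -> 0 give the bound.

    Lower limit.  The quotient at y is <A d, d> / <d, d> with d = y - x, and as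
    y approaches x inside the sphere the direction of d becomes tangent at x.
    Along y = g(s) the quotient tends to <A v, v>, so the lower limit is at most
    this number ([liminf_tangential_bound]).  Conversely
    ([tangential_bound_liminf]), two points of the sphere satisfy
    <x, d> = - <d, d> / 2, so u = d + (<d, d> / 2) x is tangent at x.  The bound
    applied to u and expanded in d is a lower estimate of the quotient that is
    polynomial in d, with value <A x, x> + (1/2) <b, x> at d = 0. *)

Set Implicit Arguments.
Unset Strict Implicit.
Unset Printing Implicit Defensive.
Import Order.TTheory GRing.Theory Num.Theory.
Import numFieldNormedType.Exports.
Local Open Scope classical_set_scope.
Local Open Scope ring_scope.

(** * The Euclidean inner product *)

Section InnerProduct.
Context (R : realType) (n : nat).
Implicit Types x y z : 'cV[R]_n.

Lemma innerE x y : inner x y = \sum_i x i 0 * y i 0.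
Proof. by rewrite /inner mxE; apply: eq_bigr => i _; rewrite mxE. Qed.

Lemma innerC x y : inner x y = inner y x.
Proof. by rewrite !innerE; apply: eq_bigr => i _; rewrite mulrC. Qed.

Lemma innerDl x y z : inner (x + y) z = inner x z + inner y z.
Proof. by rewrite /inner linearD mulmxDl mxE. Qed.

Lemma innerDr x y z : inner z (x + y) = inner z x + inner z y.
Proof. by rewrite /inner mulmxDr mxE. Qed.

Lemma innerZl a x y : inner (a *: x) y = a * inner x y.
Proof. by rewrite /inner linearZ -scalemxAl mxE. Qed.

Lemma innerZr a x y : inner x (a *: y) = a * inner x y.
Proof. by rewrite innerC innerZl innerC. Qed.

Lemma innerNl x y : inner (- x) y = - inner x y.
Proof. by rewrite -scaleN1r innerZl mulN1r. Qed.

Lemma innerNr x y : inner x (- y) = - inner x y.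
Proof. by rewrite innerC innerNl innerC. Qed.

Definition inner_lin := (innerDl, innerDr, innerZl, innerZr, innerNl, innerNr).

Lemma inner0l x : inner 0 x = 0.
Proof. by rewrite -(scale0r x) innerZl mul0r. Qed.

Lemma inner_ge0 x : 0 <= inner x x.
Proof. by rewrite innerE; apply: sumr_ge0 => i _; rewrite -expr2 sqr_ge0. Qed.

Lemma inner_gt0 x : x != 0 -> 0 < inner x x.
Proof.
move=> x0; rewrite lt_neqAle inner_ge0 andbT eq_sym.
apply: contraNN x0; rewrite innerE psumr_eq0 => [/allP x0|i _]; last first.
  by rewrite -expr2 sqr_ge0.
apply/eqP/matrixP => i j; rewrite ord1 mxE; apply/eqP.
by have := x0 i (mem_index_enum _); rewrite -expr2 sqrf_eq0.
Qed.

Lemma enorm_sqr x : enorm x ^+ 2 = inner x x.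
Proof. by rewrite sqr_sqrtr ?inner_ge0. Qed.

Lemma sphereE x : sphere R n x <-> inner x x = 1.
Proof.
rewrite /sphere /= /enorm; split => [x1|->]; last by rewrite sqrtr1.
by rewrite -enorm_sqr /enorm x1 expr1n.
Qed.

Lemma inner_sym_mulmx (A : 'M[R]_n) x y :
  A^T = A -> inner (A *m x) y = inner (A *m y) x.
Proof. by move=> hA; rewrite innerC /inner trmx_mul hA mulmxA. Qed.

(** A chord of the unit sphere is tangent at its origin up to second order. *)
Lemma inner_chord x y : sphere R n x -> sphere R n y ->
  inner x (y - x) = - (2^-1 * inner (y - x) (y - x)).
Proof.
move=> /sphereE x1 /sphereE y1.
by rewrite !inner_lin x1 y1 (innerC y x); lra.
Qed.

Lemma cvg_inner T (F : set_system T) (FF : Filter F) (f g : T -> 'cV[R]_n) a b :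
  f @ F --> a -> g @ F --> b ->
  (fun t => inner (f t) (g t)) @ F --> inner a b.
Proof.
move=> fa gb; rewrite innerE; under eq_fun do rewrite innerE.
apply: cvg_big => [|i _]; first exact: add_continuous.
have coord x : (fun y : 'cV[R]_n => y i 0) @ x --> x i 0.
  exact: (@coord_continuous R n 1 i 0 x).
exact: cvgM (cvg_comp _ _ fa (coord a)) (cvg_comp _ _ gb (coord b)).
Qed.

End InnerProduct.

(** * Great circles *)

Section GreatCircles.
Context (R : realType) (n : nat).
Implicit Types x v : 'cV[R]_n.

Definition great_circle_point x v (t : R) := cos t *: x + sin t *: v.

Lemma great_circle_point_cvg x v : great_circle_point x v t @[t --> 0] --> x.
Proof.
suff : great_circle_point x v t @[t --> 0] -->
       cos (0 : R) *: x + sin (0 : R) *: v.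
  by rewrite cos0 sin0 scale1r scale0r addr0.
by apply: cvgD; apply: cvgZr_tmp; [exact: continuous_cos|exact: continuous_sin].
Qed.

Lemma near_great_circle_interior (K : set 'cV[R]_n) x v :
  interior K x -> \forall t \near (0 : R), interior K (great_circle_point x v t).
Proof. by move=> Kx; apply: great_circle_point_cvg; exact: nbhs_interior. Qed.

Lemma inner_great_circle_point x v s t :
  sphere R n x -> sphere R n v -> inner x v = 0 ->
  inner (great_circle_point x v s) (great_circle_point x v t) = cos (t - s).
Proof.
move=> /sphereE x1 /sphereE v1 xv.
by rewrite !inner_lin x1 v1 (innerC v x) xv cosB; ring.
Qed.

Lemma great_circle_point_sphere x v t :
  sphere R n x -> sphere R n v -> inner x v = 0 ->
  sphere R n (great_circle_point x v t).
Proof.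
by move=> *; apply/sphereE; rewrite inner_great_circle_point // subrr cos0.
Qed.

Lemma inner_mulmx_great_circle_point (A : 'M[R]_n) x v t : A^T = A ->
  inner (A *m great_circle_point x v t) (great_circle_point x v t) =
  cos t ^+ 2 * inner (A *m x) x + 2 * (cos t * sin t) * inner (A *m x) v
  + sin t ^+ 2 * inner (A *m v) v.
Proof.
move=> hA; rewrite /great_circle_point mulmxDr -!scalemxAr !inner_lin.
by rewrite (inner_sym_mulmx v x hA); ring.
Qed.

Lemma dim_orthonormal2 x v : sphere R n x -> sphere R n v -> inner x v = 0 ->
  \dim <<[:: x; v]>> = 2%N.
Proof.
move=> /sphereE x1 /sphereE v1 xv.
have /eqP -> // : free [:: x; v].
rewrite free_cons seq1_free span_seq1; apply/andP; split; last first.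
  apply/eqP => v0; move: v1; rewrite v0 inner0l => /eqP.
  by rewrite eq_sym oner_eq0.
apply/negP => /vlineP [k xk]; move: x1; rewrite {2}xk innerZr xv mulr0 => /eqP.
by rewrite eq_sym oner_eq0.
Qed.

(** The endpoints of an arc of length L along any great circle have inner product
    cos L.  Hence an arc of length at most pi is shortest: a shorter competitor
    has its length in [0, pi] too, where the cosine is injective, so the two
    lengths agree after all. *)
Lemma minimal_geodesic_great_circle_point x v r :
  sphere R n x -> sphere R n v -> inner x v = 0 -> r + r <= pi ->
  minimal_geodesic `[- r, r] (great_circle_point x v).
Proof.
move=> x1 v1 xv rpi; split; first exact: interval_is_interval.
exists 1; split.
  split=> //; exists <<[:: x; v]>>%VS, x, v; split => //.
  - exact: dim_orthonormal2.
  - by split => //=; apply: memv_span; rewrite !inE eqxx.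
  - by split => //=; apply: memv_span; rewrite !inE eqxx orbT.
  - by move=> t _; rewrite mul1r.
move=> s t /=; rewrite !in_itv /= => /andP[rs sr] /andP[rt tr] st.
move=> s' t' g' k' st' [k0 [U [p [w [_ [p1 _] [w1 _] pw gE]]]]] gs gt.
rewrite mul1r leNgt; apply/negP => kt.
have : cos (t - s) = cos (k' * (t' - s')).
  rewrite -(inner_great_circle_point _ _ x1 v1 xv) -gs -gt mulrBr.
  rewrite -(inner_great_circle_point _ _ p1 w1 pw) /great_circle_point.
  by rewrite !gE //= in_itv /= lexx st'.
have ts : t - s \in `[0, pi] by rewrite in_itv /=; apply/andP; split; lra.
have ks : k' * (t' - s') \in `[0, pi].
  rewrite in_itv /= mulr_ge0 ?subr_ge0 //=.
  by move: ts; rewrite in_itv /= => /andP[_]; exact/le_trans/ltW.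
by move=> /(cos_inj ts ks) tsE; move: kt; rewrite -tsE ltxx.
Qed.

End GreatCircles.

(** * Lower limits and convex functions of a real variable *)

Lemma le_limf_einfP {R : realType} {T : choiceType} {X : filteredType T}
    (F : set_system X) (FF : Filter F) (q : X -> R) (l : R) :
  (l%:E <= limf_einf (fun y => (q y)%:E) F)%E <->
  forall e, 0 < e -> \forall y \near F, l - e <= q y.
Proof.
rewrite limf_einfE; split=> [ll e e0|ql].
  have : ((l - e)%:E < l%:E)%E by rewrite lte_fin ltrBlDr ltrDl.
  move=> /lt_le_trans /(_ ll) /ereal_sup_gt [_ [V FV <-]] eV.
  apply: filterS FV => y Vy; rewrite -lee_fin.
  by apply: (le_trans (ltW eV)); apply: ereal_inf_lbound; exists y.
apply/lee_subgt0Pr => e e0; apply: le_ereal_sup_tmp.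
exists (ereal_inf [set (q y)%:E | y in [set y | l - e <= q y]]).
  by exists [set y | l - e <= q y] => //; exact: ql.
by apply: le_ereal_inf_tmp => _ [y /= ly <-]; rewrite -EFinB lee_fin.
Qed.

Lemma convex_functionP (R : realType) (J : set R) (F : R -> R) :
  convex_function (J : set (convex_lmodType R^o)) F <->
  forall x y t, J x -> J y -> 0 <= t <= 1 ->
    F (t * x + (1 - t) * y) <= t * F x + (1 - t) * F y.
Proof.
split=> [FJ x y t Jx Jy /andP[t0 t1]|FJ t x y].
  exact: (FJ (Itv01 t0 t1) x y (mem_set Jx) (mem_set Jy)).
rewrite !inE => Jx Jy.
by apply: (FJ x y t%:num) => //; apply/andP; split.
Qed.

Lemma is_derive2_convex (R : realType) (f f' f'' : R -> R) (a b t : R) :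
  (forall x : R, is_derive x (1 : R) f (f' x)) ->
  (forall x : R, is_derive x (1 : R) f' (f'' x)) ->
  (forall x, a < x < b -> 0 <= f'' x) -> a <= b -> 0 <= t <= 1 ->
  f (t * a + (1 - t) * b) <= t * f a + (1 - t) * f b.
Proof.
move=> df df' f''0 ab /andP[t0 t1].
have Df : 'D_1 f = f' by apply/funext => x; exact: derive_val.
have cf x : {for x, continuous f}.
  by apply/differentiable_continuous/derivable1_diffP/ex_derive.
apply: (@second_derivative_convex R f a b _ _ _ _ _ (Itv01 t0 t1) ab).
- by move=> x xab; rewrite Df derive_val f''0.
- exact/cvg_at_left_filter/cf.
- exact/cvg_at_right_filter/cf.
- by move=> x _; apply: ex_derive.
- by move=> x _; rewrite Df; apply: ex_derive.
Qed.

(** The general form of a quadratic function of (cos t, sin t), hence of the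
    restriction of a quadratic function to a great circle. *)
Definition trig_quadratic (R : realType) (a m w p q c t : R) : R :=
  cos t ^+ 2 * a + 2 * (cos t * sin t) * m + sin t ^+ 2 * w
  + cos t * p + sin t * q + c.

Lemma trig_quadratic_convex (R : realType) (a m w p q c k s t l : R) :
  (forall r, s < r < t ->
     0 <= 2 * (cos (k * r) ^+ 2 - sin (k * r) ^+ 2) * (w - a)
          - 8 * (cos (k * r) * sin (k * r)) * m
          - cos (k * r) * p - sin (k * r) * q) ->
  s <= t -> 0 <= l <= 1 ->
  trig_quadratic a m w p q c (k * (l * s + (1 - l) * t)) <=
  l * trig_quadratic a m w p q c (k * s)
  + (1 - l) * trig_quadratic a m w p q c (k * t).
Proof.
move=> H st l01.
pose F (r : R) := trig_quadratic a m w p q c (k * r).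
pose F' (r : R) := k * (2 * (cos (k * r) * sin (k * r)) * (w - a)
  + 2 * (cos (k * r) ^+ 2 - sin (k * r) ^+ 2) * m
  - sin (k * r) * p + cos (k * r) * q).
pose F'' (r : R) := k ^+ 2 *
  (2 * (cos (k * r) ^+ 2 - sin (k * r) ^+ 2) * (w - a)
   - 8 * (cos (k * r) * sin (k * r)) * m
   - cos (k * r) * p - sin (k * r) * q).
apply: (is_derive2_convex (f := F) (f' := F') (f'' := F'')) => // [r|r|r rst].
- rewrite /F /trig_quadratic; apply: is_derive_eq.
  by rewrite /F' /GRing.scale /=; ring.
- rewrite /F'; apply: is_derive_eq.
  by rewrite /F'' /GRing.scale /=; ring.
- by rewrite /F'' mulr_ge0 ?sqr_ge0 ?H.
Qed.

(** * The tangential bound *)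

Section TangentialBound.
Context (R : realType) (n : nat) (K : set 'cV[R]_n).
Context (A : 'M[R]_n) (b : 'cV[R]_n) (c : R).
Hypothesis hA : A^T = A.
Implicit Types x y v : 'cV[R]_n.

Definition tangential_bound :=
  forall x v, (sphere R n `&` interior K) x -> sphere R n v -> inner x v = 0 ->
  inner (A *m x) x + 2^-1 * inner b x <= inner (A *m v) v.

Lemma tangential_bound_homogeneous x u : tangential_bound ->
  (sphere R n `&` interior K) x -> inner x u = 0 ->
  (inner (A *m x) x + 2^-1 * inner b x) * inner u u <= inner (A *m u) u.
Proof.
move=> AK Kx xu; have [->|u0] := eqVneq u 0.
  by rewrite mulmx0 !inner0l mulr0.
have uu0 := inner_gt0 u0.
have e0 : enorm u != 0 by rewrite /enorm sqrtr_eq0 -ltNge.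
have := AK x ((enorm u)^-1 *: u) Kx.
rewrite -scalemxAr !inner_lin xu mulr0 => /(_ _ erefl).
rewrite -ler_pdivlMr// -enorm_sqr => bound; apply: (le_trans (bound _)).
  by apply/sphereE; rewrite !inner_lin -enorm_sqr; field.
by rewrite le_eqVlt; apply/orP; left; apply/eqP; field.
Qed.

(** * The tangential bound and the lower limit *)

Definition chord_quotient x y :=
  inner (A *m y - A *m x) (y - x) / enorm (y - x) ^+ 2.

Lemma tangential_bound_liminf x :
  tangential_bound -> (sphere R n `&` interior K) x ->
  ((inner (A *m x) x + 2^-1 * inner b x)%:E <=
   limf_einf (fun y => (chord_quotient x y)%:E)
             (within (sphere R n `&` K) (dnbhs x)))%E.
Proof.
move=> AK Kx; apply/le_limf_einfP => e e0.
set l := inner (A *m x) x + _.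
(* h d is what the bound for u = d + (<d, d> / 2) x gives after division by
   <d, d>: there, <u, u> = <d, d> - <d, d>^2 / 4. *)
pose k := 4^-1 * (l + inner (A *m x) x).
pose h (d : 'cV[R]_n) := l - inner (A *m x) d - k * inner d d.
have h0 : h (y - x) @[y --> nbhs x] --> l.
  have d0 : y - x @[y --> nbhs x] --> (0 : 'cV[R]_n).
    rewrite -[X in _ --> X](subrr x).
    by apply: cvgB; [exact: cvg_id|exact: cvg_cst].
  have -> : l = h 0 by rewrite /h innerC !inner0l mulr0 !subr0.
  apply: cvgB; [apply: cvgB; first exact: cvg_cst
               |apply: cvgM; first exact: cvg_cst].
    by apply: cvg_inner => //; exact: cvg_cst.
  exact: cvg_inner.
have : l - e < l by rewrite ltrBlDr ltrDl.
move=> /(cvgr_gt _ h0) /= h_near.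
rewrite near_withinE; near=> y => -[y1 Ky].
have yx : y - x != 0 by rewrite subr_eq0; near: y; exact: nbhs_dnbhs_neq.
have ley : l - e < h (y - x) by near: y; exact: nbhs_dnbhs.
apply: le_trans (ltW ley) _.
rewrite /chord_quotient enorm_sqr -mulmxBr.
have xd := inner_chord Kx.1 y1.
move: (y - x) yx xd {ley} => d d0 xd.
rewrite ler_pdivlMr ?inner_gt0// /h /k.
have x1 : inner x x = 1 by apply/sphereE; exact: Kx.1.
pose u := d + 2^-1 * inner d d *: x.
have /(tangential_bound_homogeneous AK Kx) : inner x u = 0.
  by rewrite /u !inner_lin xd x1 mulr1 addNr.
rewrite -/l /u mulmxDr -scalemxAr !inner_lin (innerC d x) xd x1.
rewrite (inner_sym_mulmx _ x hA); lra.
Unshelve. all: by end_near.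
Qed.

(** Along a great circle the chord quotient is an explicit function of the
    parameter, which extends continuously to the parameter 0. *)
Lemma chord_quotient_great_circle_point x v s :
  sphere R n x -> sphere R n v -> inner x v = 0 -> cos s < 1 ->
  chord_quotient x (great_circle_point x v s) =
  2^-1 * ((1 - cos s) * inner (A *m x) x - 2 * sin s * inner (A *m x) v
          + (1 + cos s) * inner (A *m v) v).
Proof.
move=> /sphereE x1 /sphereE v1 xv; rewrite -subr_gt0 => c1.
have dE : great_circle_point x v s - x = (cos s - 1) *: x + sin s *: v.
  by rewrite /great_circle_point scalerBl scale1r addrAC.
have ss : sin s * sin s = (1 - cos s) * (1 + cos s).
  by rewrite -expr2 sin2cos2; ring.
rewrite /chord_quotient enorm_sqr -mulmxBr dE mulmxDr -!scalemxAr !inner_lin.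
rewrite (inner_sym_mulmx v x hA) (innerC v x) x1 v1 xv.
rewrite [sin s * (sin s * inner _ _)]mulrA !(mulr0, mulr1, add0r, addr0) ss.
have -> : (cos s - 1) * (cos s - 1) + (1 - cos s) * (1 + cos s) =
          2 * (1 - cos s) by ring.
by field; rewrite gt_eqF.
Qed.

Lemma liminf_tangential_bound :
  (forall x, (sphere R n `&` interior K) x ->
   ((inner (A *m x) x + 2^-1 * inner b x)%:E <=
    limf_einf (fun y => (chord_quotient x y)%:E)
              (within (sphere R n `&` K) (dnbhs x)))%E) ->
  tangential_bound.
Proof.
move=> lim x v Kx v1 xv; apply/ler_addgt0Pr => e e0; rewrite -lerBlDr.
have /le_limf_einfP /(_ e e0) near_x := lim x Kx.
pose q (s : R) := 2^-1 * ((1 - cos s) * inner (A *m x) x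
  - 2 * sin s * inner (A *m x) v + (1 + cos s) * inner (A *m v) v).
have qw : q s @[s --> 0^'+] --> inner (A *m v) v.
  have cq : {for 0, continuous q}.
    apply/differentiable_continuous/derivable1_diffP.
    by rewrite /q; apply: ex_derive.
  have -> : inner (A *m v) v = q 0 by rewrite /q cos0 sin0; field.
  exact: cvg_at_right_filter.
apply: (cvgr_to_ge qw); near=> s.
set y := great_circle_point x v s.
have s0 : 0 < s by near: s; exact: nbhs_right_gt.
have sin0 : 0 < sin s.
  by apply: sin_gt0_pi; rewrite s0 /=; near: s; exact/nbhs_right_lt/pi_gt0.
have c1 : cos s < 1.
  rewrite lt_neqAle cos_le1 andbT; apply/eqP => c1.
  by have := cos2Dsin2 s; rewrite c1; nra.
have y1 : sphere R n y by apply: great_circle_point_sphere => //; exact: Kx.1.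
have Ky : K y.
  apply: interior_subset; rewrite /y; near: s.
  exact: cvg_within _ (near_great_circle_interior v Kx.2).
have yx : y != x.
  apply/eqP => /(congr1 (inner v)).
  by move/sphereE in v1; rewrite !inner_lin v1 (innerC v x) xv; lra.
rewrite /q -chord_quotient_great_circle_point //; last exact: Kx.1.
have : (sphere R n `&` K) y ->
  inner (A *m x) x + 2^-1 * inner b x - e <= chord_quotient x y.
  move: yx; rewrite /y; near: s; apply: cvg_within.
  exact: (@great_circle_point_cvg R n x v _ near_x).
exact.
Unshelve. all: by end_near.
Qed.

(** * The tangential bound and spherical convexity *)

Local Notation f := (fun x => inner (A *m x) x + inner b x + c).

Lemma quadratic_great_circle_point x v t :
  f (great_circle_point x v t) =
  trig_quadratic (inner (A *m x) x) (inner (A *m x) v) (inner (A *m v) v)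
    (inner b x) (inner b v) c t.
Proof.
rewrite /= inner_mulmx_great_circle_point // /trig_quadratic.
by rewrite /great_circle_point !inner_lin !addrA.
Qed.

Lemma spherically_convex_tangential_bound :
  spherically_convex K f -> tangential_bound.
Proof.
move=> fconv x v Kx v1 xv.
set a := inner (A *m x) x; set p := inner b x; set w := inner (A *m v) v.
pose q (s : R) := 2^-1 * (1 + cos s) * (w - a).
suff : 2^-1 * p <= w - a by lra.
have qw : q s @[s --> 0^'+] --> w - a.
  have cq : {for 0, continuous q}.
    apply/differentiable_continuous/derivable1_diffP.
    by rewrite /q; apply: ex_derive.
  have -> : w - a = q 0 by rewrite /q cos0; field.
  exact: cvg_at_right_filter.
have /nbhs_ballP [r /= r0 rK] := near_great_circle_interior v Kx.2.
apply: (cvgr_to_ge qw); near=> s.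
have s0 : 0 < s by near: s; exact: nbhs_right_gt.
(* s < 1 makes the arc of parameters [-s, s] shorter than 2 <= pi. *)
have s1 : s < 1 by near: s; exact: nbhs_right_lt.
have sr : s < r by near: s; exact: nbhs_right_lt.
have pi2 := pi_ge2 R.
have geo : minimal_geodesic `[- s, s] (great_circle_point x v).
  by apply: minimal_geodesic_great_circle_point => //; [exact: Kx.1|lra].
have JK t : `[- s, s]%classic t ->
    (sphere R n `&` interior K) (great_circle_point x v t).
  rewrite /= in_itv /= => /andP[t0 t1]; split.
    exact: great_circle_point_sphere Kx.1 v1 xv.
  by apply: rK; rewrite /ball /= sub0r normrN ltr_norml; lra.
have /convex_functionP /(_ (- s) s 2^-1) := fconv _ _ geo JK.
rewrite /= !in_itv /= !quadratic_great_circle_point /trig_quadratic.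
have -> : 2^-1 * - s + (1 - 2^-1) * s = 0 by field.
rewrite cosN sinN cos0 sin0 -/a -/p -/w sqrrN sin2cos2 => conv.
have c1 : 0 < 1 - cos s.
  by rewrite subr_gt0 -[X in _ < X]cos0 ltr_cos ?in_itv //=; lra.
rewrite -(ler_pM2l c1) /q.
have ss : - s <= s by lra.
have half01 : 0 <= (2^-1 : R) <= 1 by apply/andP; split; lra.
by move: conv; rewrite !lexx ss half01 => /(_ isT isT isT); lra.
Unshelve. all: by end_near.
Qed.

Lemma tangential_bound_spherically_convex :
  tangential_bound -> spherically_convex K f.
Proof.
move=> AK J g [Jitv [k [[k0 [U [p [v [_ [p1 _] [v1 _] pv gE]]]]] _]]] gK.
apply/convex_functionP => s t l Js Jt /andP[l0 l1].
wlog : s t l Js Jt l0 l1 / s <= t => [wl|st].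
  have [st|/ltW ts] := leP s t; first exact: wl.
  have := wl t s (1 - l) Jt Js.
  rewrite subKr subr_ge0 gerBl l0 l1 => /(_ isT isT ts).
  by rewrite addrC [leRHS]addrC.
have fgE r : J r -> (f \o g) r =
    trig_quadratic (inner (A *m p) p) (inner (A *m p) v) (inner (A *m v) v)
      (inner b p) (inner b v) c (k * r).
  by move=> Jr; rewrite /= (gE r Jr) -quadratic_great_circle_point.
have Jst r : s <= r <= t -> J r by exact: Jitv.
rewrite !fgE //; last by apply: Jst; apply/andP; split; nra.
apply: trig_quadratic_convex => // [r /andP[sr rt]|]; last by rewrite l0.
have Jr : J r by apply: Jst; rewrite !ltW.
(* A quarter turn ahead of g r lies its unit tangent vector. *)
have := AK (g r) (great_circle_point p v (k * r + pi / 2)) (gK r Jr).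
rewrite (gE r Jr) -/(great_circle_point p v (k * r)).
rewrite inner_great_circle_point // [_ + _ - _]addrAC subrr add0r cos_pihalf.
move=> /(_ (great_circle_point_sphere _ p1 v1 pv) erefl).
rewrite !inner_mulmx_great_circle_point // cosDpihalf sinDpihalf.
rewrite /great_circle_point !inner_lin; lra.
Qed.

End TangentialBound.

Theorem theorem2 (R : realType) (n : nat) (hn : (3 <= n)%N)
    (K : set 'cV[R]_n) (hK : proper_cone K)
    (A : 'M[R]_n) (hA : A^T = A) (b : 'cV[R]_n) (c : R) :
  spherically_convex K (fun x => inner (A *m x) x + inner b x + c) <->
  forall x : 'cV[R]_n, (sphere R n `&` interior K) x ->
    ((2^-1 * inner b x)%:E <=
     limf_einf
       (fun y : 'cV[R]_n =>
          (inner (A *m y - A *m x) (y - x) / enorm (y - x) ^+ 2)%:E)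
       (within (sphere R n `&` K) (dnbhs x))
     - (inner (A *m x) x)%:E)%E.
Proof.
split=> [fconv x Kx|lim].
  rewrite leeBrDr // -EFinD addrC; apply: tangential_bound_liminf => //.
  exact: spherically_convex_tangential_bound fconv.
apply: tangential_bound_spherically_convex => //.
apply: liminf_tangential_bound => // x Kx.
by have := lim x Kx; rewrite leeBrDr // -EFinD addrC.
Qed.
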